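(* If $G$ is a finite directed acyclic graph, then $\mathrm{DT}(G)$ is homotopy equivalent to a wedge of $\prod_{v\in V(G)\setminus R}(d^-(v)-1)$ spheres of dimension $\#V(G)-\#R-1$, where $R$ is the set of vertices of $G$ without edges directed to them.
   Context: A directed acyclic graph has no directed cycles. A directed forest is a set of edges which, as a graph, is acyclic with at most one edge directed to each vertex. $\mathrm{DT}(G)$ is the simplicial complex with vertex set $E(G)$ whose simplices are the directed forests. $d^-(v)$ denotes the number of edges of $G$ directed to $v$. A wedge of zero spheres means a point (contractible). *)

(* Defs.v *)
From HB Require Import structures.
From mathcomp Require Import all_boot all_order all_algebra.
From mathcomp Require Import all_classical all_reals all_analysis.
From mathcomp Require Import homotopy.


Unset Strict Implicit.
Unset Printing Implicit Defensive.

Import Order.TTheory GRing.Theory Num.Theory.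
Import numFieldNormedType.Exports.
Local Open Scope classical_set_scope.
Local Open Scope ring_scope.

(* A (simple) directed graph on a finite vertex type V is a relation e : rel V;
   e u v means there is an edge u -> v. *)

Definition acyclic_rel {V : finType} (e : rel V) : Prop :=
  forall (v : V) (p : seq V), path e v p -> last v p = v -> p = [::].

Definition edge {V : finType} (e : rel V) : finType :=
  {x : V * V | e x.1 x.2}.

Definition indeg {V : finType} (e : rel V) (v : V) : nat :=
  #|[set x : edge e | (val x).2 == v]|.

Definition sources {V : finType} (e : rel V) : {set V} :=
  [set v | indeg e v == 0%N].

Definition rel_of_edges {V : finType} (e : rel V) (F : {set edge e}) : rel V :=
  fun u w => [exists x in F, val x == (u, w)].

Definition directed_forest {V : finType} (e : rel V) (F : {set edge e}) : Prop :=
  acyclic_rel (rel_of_edges e F) /\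
  forall v : V, (#|[set x in F | (val x).2 == v]| <= 1)%N.

(* geometric realization of DT(G): points of the standard simplex in R^{E(G)}
   whose support is a directed forest, with the subspace topology of the
   product topology. *)
Definition DT_realization_set (R : realType) {V : finType} (e : rel V)
  : set (prod_topology (fun _ : edge e => (R : topologicalType))) :=
  [set f | (forall x, 0 <= f x) /\ \sum_(x : edge e) f x = 1 /\
           directed_forest e [set x : edge e | f x != 0]].

Definition DT_realization (R : realType) {V : finType} (e : rel V)
  : topologicalType := (set_type (DT_realization_set R e) : topologicalType).

Definition sphere_set (R : realType) (n : nat) : set 'rV[R]_(n.+1) :=
  [set x | \sum_(i < n.+1) (x ord0 i) ^+ 2 = 1].

Definition sphere (R : realType) (n : nat) : topologicalType :=
  (set_type (sphere_set R n) : topologicalType).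

Lemma sphere_pt_proof (R : realType) (n : nat) :
  (\row_(i < n.+1) (if i == ord0 then 1 else 0 : R)) \in sphere_set R n.
Proof.
apply/mem_set; rewrite /sphere_set /= (bigD1 ord0) //= mxE eqxx expr1n.
rewrite big1 ?addr0 // => i /negPf Hi; by rewrite mxE Hi expr0n.
Qed.

Definition sphere_pt (R : realType) (n : nat) : sphere R n :=
  SigSub (sphere_pt_proof R n).

Definition wedge_spheres (R : realType) (k n : nat) : topologicalType :=
  (@wedge _ (fun _ : 'I_k => sphere R n) (fun _ => sphere_pt R n) : topologicalType).

Definition unit_interval (R : realType) : topologicalType :=
  (set_type [set t : R | 0 <= t <= 1] : topologicalType).

Definition homotopic (R : realType) (X Y : topologicalType) (f g : X -> Y) : Prop :=
  exists H : (X * unit_interval R)%type -> Y,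
    continuous H /\
    (forall x (t : unit_interval R), sval t = 0 -> H (x, t) = f x) /\
    (forall x (t : unit_interval R), sval t = 1 -> H (x, t) = g x).

Definition homotopy_equivalent (R : realType) (X Y : topologicalType) : Prop :=
  exists (f : X -> Y) (g : Y -> X),
    continuous f /\ continuous g /\
    homotopic R X X (g \o f) idfun /\ homotopic R Y Y (f \o g) idfun.

Definition point_space (R : realType) : topologicalType := (set_type [set (0 : R)] : topologicalType).
Definition empty_space (R : realType) : topologicalType := (set_type (@set0 R) : topologicalType).

(* "X is homotopy equivalent to a wedge of k spheres of dimension d", d : int.
   A wedge of zero spheres is a point; the (-1)-sphere is empty (only relevant
   when k = 1, d = -1). *)
Definition htpy_wedge_of_spheres (R : realType) (X : topologicalType)
  (k : nat) (d : int) : Prop :=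
  if k == 0%N then homotopy_equivalent R X (point_space R)
  else match d with
       | Posz n => homotopy_equivalent R X (wedge_spheres R k n)
       | Negz _ => homotopy_equivalent R X (empty_space R)
       end.

(* Main.v *)
(** Since the graph is acyclic, a set of edges is a directed forest as soon as
    it contains at most one edge into each vertex, so [DT(G)] is the join of
    the finite discrete sets [E_v] of edges into the [n+1] vertices [v] that
    are not sources.  Choose [a_v] in each [E_v].  A choice [s] of another
    edge [s_v] in each [E_v] spans an n-sphere: the boundary of the
    cross-polytope with opposite vertices [a_v] (positive) and [s_v]
    (negative).  There are [prod_v (d^-(v) - 1)] of them, and their open
    negative orthants are disjoint.  Pushing every point in the direction
    [(1,...,1)], more slowly near the barycentres of the negative orthants so
    that no sphere passes through the origin, ends with a map that collapses
    the complement of these orthants to a point.  The push never makes a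
    coordinate negative, so it is compatible on overlapping spheres: it is
    defined on the whole join, where it connects the identity to the composite
    join -> wedge -> join, and on each sphere, where it connects the identity
    to the composite wedge -> join -> wedge. *)

Require Import Defs.
From HB Require Import structures.
From mathcomp Require Import all_boot all_order all_algebra.
From mathcomp Require Import all_classical all_reals all_analysis.
From mathcomp Require Import homotopy.
From mathcomp Require Import ring lra.

Set Implicit Arguments.
Unset Strict Implicit.
Unset Printing Implicit Defensive.

Import Order.TTheory GRing.Theory Num.Theory.
Import numFieldNormedType.Exports.
Local Open Scope classical_set_scope.
Local Open Scope ring_scope.

(** * Continuity into subspaces, products and row vectors, and of real-valued expressions *)

Section Continuity.
Context {R : realType}.

Lemma continuous_set_type {T X : topologicalType} (A : set X)
    (f : T -> set_type A) :
  continuous (fun x => set_val (f x)) -> continuous f.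
Proof. by move=> cf; apply: (@continuous_comp_initial _ _ _ set_val f). Qed.

Lemma continuous_set_val {X : topologicalType} (A : set X) :
  continuous (set_val : set_type A -> X).
Proof. exact: initial_continuous. Qed.

Lemma continuous_prod_topology {T : topologicalType} {I : choiceType}
    (F : T -> prod_topology (fun _ : I => (R : topologicalType))) :
  (forall i, continuous (fun x => F x i)) -> continuous F.
Proof.
move=> cF x; apply/cvg_sup => i U [_ [[W oW <-] WFx] WU].
apply: (filterS WU); apply: (cF i x W); exact: open_nbhs_nbhs.
Qed.

Lemma continuous_row {T : topologicalType} {n : nat}
    (F : T -> 'rV[R]_n) :
  (forall i, continuous (fun x => F x ord0 i)) -> continuous F.
Proof.
move=> cF x; apply/cvg_mx_entourageP => A entA.
have : forall i, \forall y \near x, (F x ord0 i, F y ord0 i) \in A.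
  move=> i; near do rewrite inE; have /cvg_entourageP := cF i x; exact.
move=> /filter_forall nA; apply: filterS nA => y Ay i j.
by rewrite (ord1 i); exact: Ay.
Unshelve. all: by end_near. Qed.

Context {T : topologicalType}.
Implicit Types f g : T -> R.

Lemma continuousDr f g :
  continuous f -> continuous g -> continuous (fun x => f x + g x).
Proof. by move=> cf cg x; apply: cvgD; [exact: cf|exact: cg]. Qed.

Lemma continuousNr f : continuous f -> continuous (fun x => - f x).
Proof. by move=> cf x; apply: cvgN; exact: cf. Qed.

Lemma continuousMr f g :
  continuous f -> continuous g -> continuous (fun x => f x * g x).
Proof. by move=> cf cg x; apply: cvgM; [exact: cf|exact: cg]. Qed.

Lemma continuousVr f : (forall x, f x != 0) ->
  continuous f -> continuous (fun x => (f x)^-1).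
Proof. by move=> f0 cf x; apply: cvgV; [exact: f0|exact: cf]. Qed.

Lemma continuous_cstr (c : R) : continuous (fun _ : T => c).
Proof. by move=> x; exact: cvg_cst. Qed.

Lemma continuous_normr f : continuous f -> continuous (fun x => `|f x|).
Proof. by move=> cf x; apply: cvg_norm; exact: cf. Qed.

Lemma continuous_maxr f g :
  continuous f -> continuous g -> continuous (fun x => Num.max (f x) (g x)).
Proof. by move=> cf cg x; apply: continuous_max; [exact: cf|exact: cg]. Qed.

Lemma continuous_minr f g :
  continuous f -> continuous g -> continuous (fun x => Num.min (f x) (g x)).
Proof. by move=> cf cg x; apply: continuous_min; [exact: cf|exact: cg]. Qed.

Lemma continuous_sqrtr f :
  continuous f -> continuous (fun x => Num.sqrt (f x)).
Proof.
move=> cf x; apply: (@continuous_comp _ _ _ f (@Num.sqrt R)); first exact: cf.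
exact: sqrt_continuous.
Qed.

Lemma continuous_sumr (I : finType) (P : pred I) (F : T -> I -> R) :
  (forall i, continuous (F^~ i)) ->
  continuous (fun x => \sum_(i | P i) F x i).
Proof. by move=> cF; apply: continuous_big => [|i _]; [exact: add_continuous|exact: cF]. Qed.

End Continuity.

(** * Rescaling to l1 norm 1 (simplices, cross-polytopes) and to l2 norm 1 (round spheres) *)

Section Normalization.
Context {R : realType}.

Definition normalize1 (I : finType) (z : I -> R) (i : I) : R :=
  z i / \sum_j `|z j|.

Definition normalize2 (I : finType) (z : I -> R) (i : I) : R :=
  z i / Num.sqrt (\sum_j z j ^+ 2).

Context {I : finType}.
Implicit Types z : I -> R.

Lemma sum_norm_gt0 z : (exists i, z i != 0) -> 0 < \sum_i `|z i|.
Proof.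
move=> [i zi0]; rewrite (bigD1 i) //= ltr_pwDl ?normr_gt0 //.
exact: sumr_ge0.
Qed.

Lemma sum_sqr_gt0 z : (exists i, z i != 0) -> 0 < \sum_i z i ^+ 2.
Proof.
move=> [i zi0]; rewrite (bigD1 i) //= ltr_pwDl ?exprn_even_gt0 //.
by apply: sumr_ge0 => j _; exact: sqr_ge0.
Qed.

Lemma sum_norm_normalize1 z :
  (exists i, z i != 0) -> \sum_i `|normalize1 z i| = 1.
Proof.
move=> /sum_norm_gt0 z0; rewrite /normalize1.
under eq_bigr do rewrite normrM normfV (gtr0_norm z0).
by rewrite -mulr_suml divff // gt_eqF.
Qed.

Lemma sum_sqr_normalize2 z :
  (exists i, z i != 0) -> \sum_i normalize2 z i ^+ 2 = 1.
Proof.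
move=> /sum_sqr_gt0 z0; rewrite /normalize2.
under eq_bigr do rewrite expr_div_n sqr_sqrtr ?(ltW z0) //.
by rewrite -mulr_suml divff // gt_eqF.
Qed.

Lemma normalize1_id z : \sum_i `|z i| = 1 -> normalize1 z = z.
Proof. by move=> z1; apply/funext => i; rewrite /normalize1 z1 divr1. Qed.

Lemma normalize2_id z : \sum_i z i ^+ 2 = 1 -> normalize2 z = z.
Proof.
by move=> z1; apply/funext => i; rewrite /normalize2 z1 sqrtr1 divr1.
Qed.

Lemma normalize1_scale (c : R) z :
  0 < c -> normalize1 (fun i => c * z i) = normalize1 z.
Proof.
move=> c0; apply/funext => i; rewrite /normalize1.
under eq_bigr do rewrite normrM (gtr0_norm c0).
by rewrite -mulr_sumr -mulf_div divff ?mul1r // gt_eqF.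
Qed.

Lemma normalize2_scale (c : R) z :
  0 < c -> normalize2 (fun i => c * z i) = normalize2 z.
Proof.
move=> c0; apply/funext => i; rewrite /normalize2.
under eq_bigr do rewrite exprMn.
rewrite -mulr_sumr sqrtrM ?sqr_ge0 // sqrtr_sqr gtr0_norm //.
by rewrite -mulf_div divff ?mul1r // gt_eqF.
Qed.

(** Exposes only a positive factor, which commutes with the positively homogeneous maps [signed],
    [lift] and [shear]. *)
Lemma normalize1E z : (exists i, z i != 0) ->
  exists2 c, 0 < c & normalize1 z = fun i => c * z i.
Proof.
move=> /sum_norm_gt0 z0; exists (\sum_j `|z j|)^-1; first by rewrite invr_gt0.
by apply/funext => i; rewrite mulrC.
Qed.

Lemma normalize2E z : (exists i, z i != 0) ->
  exists2 c, 0 < c & normalize2 z = fun i => c * z i.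
Proof.
move=> /sum_sqr_gt0 z0; exists (Num.sqrt (\sum_j z j ^+ 2))^-1.
  by rewrite invr_gt0 sqrtr_gt0.
by apply/funext => i; rewrite mulrC.
Qed.

Context {T : topologicalType}.
Implicit Type F : T -> I -> R.

Lemma normalize1_continuous F i : (forall x, exists i, F x i != 0) ->
  (forall i, continuous (F^~ i)) -> continuous (fun x => normalize1 (F x) i).
Proof.
move=> F0 cF; apply: continuousMr => //; apply: continuousVr.
  by move=> x; rewrite gt_eqF // sum_norm_gt0.
by apply: continuous_sumr => j; exact: continuous_normr.
Qed.

Lemma normalize2_continuous F i : (forall x, exists i, F x i != 0) ->
  (forall i, continuous (F^~ i)) -> continuous (fun x => normalize2 (F x) i).
Proof.
move=> F0 cF; apply: continuousMr => //; apply: continuousVr.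
  by move=> x; rewrite gt_eqF // sqrtr_gt0 sum_sqr_gt0.
apply: continuous_sqrtr; apply: continuous_sumr => j.
by under eq_fun do rewrite expr2; exact: continuousMr.
Qed.

End Normalization.

(** * The push towards [(1,...,1)] on the boundary of the cross-polytope *)

Section Push.
Context {R : realType} {n : nat}.
Implicit Types (t : R) (y : 'I_n.+1 -> R).

(* With [sum_i |y_i| = 1], the sum is [0] only at the barycentre
   [y = -(1,...,1)/(n+1)] and is at least [1] when some [y_i] is nonnegative. *)
Definition tilt t y : R := t * Num.min 1 (\sum_i `|n.+1%:R * y i + 1|).

Definition push t y (i : 'I_n.+1) : R := (1 - tilt t y) * y i + tilt t y.

Lemma tilt0 y : tilt 0 y = 0.
Proof. by rewrite /tilt mul0r. Qed.

Lemma tilt_ge0 t y : 0 <= t -> 0 <= tilt t y.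
Proof. by move=> t0; rewrite mulr_ge0 // le_min ler01 sumr_ge0. Qed.

Lemma tilt_le1 t y : 0 <= t <= 1 -> tilt t y <= 1.
Proof.
move=> /andP[t0 t1]; rewrite -[leRHS](mulr1 1) ler_pM //.
  by rewrite le_min ler01 sumr_ge0.
by rewrite ge_min lexx.
Qed.

Lemma tilt1 y i : 0 <= y i -> tilt 1 y = 1.
Proof.
move=> yi0; rewrite /tilt mul1r; apply/min_idPl.
rewrite (bigD1 i) //= -[leLHS]addr0 lerD ?sumr_ge0 //.
have : 0 <= n.+1%:R * y i by rewrite mulr_ge0.
by move=> ?; rewrite ger0_norm; lra.
Qed.

Lemma push0 y : push 0 y = y.
Proof. by apply/funext => i; rewrite /push tilt0 subr0 mul1r addr0. Qed.

(** The collapse: at time 1 everything outside the open negative orthant has reached one point. *)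
Lemma push1 y i : 0 <= y i -> push 1 y = fun=> 1.
Proof.
by move=> yi; apply/funext => j; rewrite /push (tilt1 yi) subrr mul0r add0r.
Qed.

(** With tilt [1] the result is [(1,...,1)]. With tilt [u < 1], a zero result makes every [y i]
    equal to [-u/(1-u)], so norm 1 forces the negative barycentre; there the tilt vanishes, whence
    [y = 0], a contradiction. *)
Lemma push_neq0 t y : 0 <= t <= 1 -> \sum_i `|y i| = 1 ->
  exists i, push t y i != 0.
Proof.
move=> t01 y1; apply: contrapT => /forallNP P0.
have {}P0 i : push t y i = 0 by apply/eqP/negPn/negP/P0.
have := tilt_le1 y t01; have := @tilt_ge0 t y; rewrite /push in P0.
move: t01 => /andP[t0 t1] /(_ t0); case: (eqVneq (tilt t y) 1) => [E|tN1 T0 T1].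
  by have := P0 ord0; rewrite E subrr mul0r add0r => /eqP; rewrite oner_eq0.
set l := tilt t y / (1 - tilt t y).
have d0 : 0 < 1 - tilt t y by rewrite subr_gt0 lt_neqAle tN1.
have l0 : 0 <= l by rewrite divr_ge0 // ltW.
have yE i : y i = - l.
  by apply: (mulfI (lt0r_neq0 d0)); rewrite mulrN mulrC -[_ * l]mulrC divfK ?lt0r_neq0 //;
     have := P0 i; lra.
have E : n.+1%:R * l = 1.
  rewrite -[RHS]y1; under eq_bigr do rewrite yE normrN ger0_norm //.
  by rewrite sumr_const card_ord mulr_natl.
have T00 : tilt t y = 0.
  rewrite /tilt big1 ?min_r ?mulr0 // => i _.
  by rewrite yE mulrN E addNr normr0.
by move: E; rewrite /l T00 mul0r mulr0 => /esym/eqP; rewrite oner_eq0.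
Qed.

(* Maps the base point of the sphere, its first basis vector, to the direction
   [(1,...,1)] of the push. *)
Definition shear y i : R := if i == ord0 then y i else y i + y ord0.

Definition unshear y i : R := if i == ord0 then y i else y i - y ord0.

Lemma shearK y : unshear (shear y) = y.
Proof.
apply/funext => i; rewrite /unshear /shear eqxx.
by case: eqP => // _; rewrite addrK.
Qed.

Lemma unshearK y : shear (unshear y) = y.
Proof.
apply/funext => i; rewrite /unshear /shear eqxx.
by case: eqP => // _; rewrite subrK.
Qed.

Lemma shearZ (c : R) y : shear (fun i => c * y i) = fun i => c * shear y i.
Proof. by apply/funext => i; rewrite /shear; case: ifP => _; rewrite ?mulrDr. Qed.

Lemma unshearZ (c : R) y :
  unshear (fun i => c * y i) = fun i => c * unshear y i.
Proof.
by apply/funext => i; rewrite /unshear; case: ifP => _; rewrite ?mulrBr.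
Qed.

Lemma unshear1 : unshear (fun=> 1) = fun i => (i == ord0)%:R.
Proof. by apply/funext => i; rewrite /unshear subrr; case: eqP. Qed.

Lemma shear_delta : shear (fun i => (i == ord0)%:R) = fun=> 1.
Proof. by rewrite -unshear1 unshearK. Qed.

Lemma shear_neq0 y : (exists i, y i != 0) -> exists i, shear y i != 0.
Proof.
move=> [i yi]; apply: contrapT => /forallNP H; move/eqP: yi; apply.
(* Zero is written as a multiple so that [unshearZ] applies. *)
rewrite -(shearK y); have -> : shear y = fun=> 0 * 1.
  by apply/funext => j; rewrite mul0r; apply/eqP/negPn/negP/H.
by rewrite unshearZ mul0r.
Qed.

Lemma unshear_neq0 y : (exists i, y i != 0) -> exists i, unshear y i != 0.
Proof.
move=> [i yi]; apply: contrapT => /forallNP H; move/eqP: yi; apply.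
rewrite -(unshearK y); have -> : unshear y = fun=> 0 * 1.
  by apply/funext => j; rewrite mul0r; apply/eqP/negPn/negP/H.
by rewrite shearZ mul0r.
Qed.

Context {T : topologicalType}.
Implicit Types (u : T -> R) (F : T -> 'I_n.+1 -> R).

Lemma tilt_continuous u F : continuous u -> (forall i, continuous (F^~ i)) ->
  continuous (fun x => tilt (u x) (F x)).
Proof.
move=> cu cF; apply: continuousMr => //.
apply: continuous_minr; first exact: continuous_cstr.
apply: continuous_sumr => i; apply/continuous_normr/continuousDr.
  by apply: continuousMr => //; exact: continuous_cstr.
exact: continuous_cstr.
Qed.

Lemma push_continuous u F i : continuous u -> (forall i, continuous (F^~ i)) ->
  continuous (fun x => push (u x) (F x) i).
Proof.
move=> cu cF; have ct := tilt_continuous cu cF.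
apply: continuousDr => //; apply: continuousMr => //; apply: continuousDr.
  exact: continuous_cstr.
exact: continuousNr.
Qed.

Lemma shear_continuous F i : (forall i, continuous (F^~ i)) ->
  continuous (fun x => shear (F x) i).
Proof.
by move=> cF; rewrite /shear; case: eqP => // _; exact: continuousDr.
Qed.

Lemma unshear_continuous F i : (forall i, continuous (F^~ i)) ->
  continuous (fun x => unshear (F x) i).
Proof.
move=> cF; rewrite /unshear; case: eqP => // _.
by apply: continuousDr => //; exact: continuousNr.
Qed.

End Push.

(** * Coordinates on the round sphere *)

Section SphereCoordinates.
Context {R : realType} {n : nat}.

Definition coords (w : sphere R n) (i : 'I_n.+1) : R := set_val w ord0 i.

(* Radial projection; the origin is sent to the base point. *)
Definition to_sphere (z : 'I_n.+1 -> R) : sphere R n :=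
  insubd (sphere_pt R n) (\row_i normalize2 z i).

Lemma coords_to_sphere z :
  (exists i, z i != 0) -> coords (to_sphere z) = normalize2 z.
Proof.
move=> z0; apply/funext => i; rewrite /coords /to_sphere.
rewrite [set_val _](@insubdK _ _ _ (sphere_pt R n)) ?mxE //.
apply/mem_set; rewrite /sphere_set /=.
by under eq_bigr do rewrite mxE; exact: sum_sqr_normalize2.
Qed.

Lemma sum_sqr_coords w : \sum_i coords w i ^+ 2 = 1.
Proof. exact: (set_mem (valP w)). Qed.

Lemma coords_neq0 w : exists i, coords w i != 0.
Proof.
apply: contrapT => /forallNP H; have := sum_sqr_coords w.
rewrite big1; first by move=> /esym/eqP; rewrite oner_eq0.
by move=> i _; apply/eqP; rewrite sqrf_eq0; apply/negPn/negP/H.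
Qed.

Lemma coords_inj : injective coords.
Proof.
move=> v w vw; apply/val_inj/rowP => i.
exact: (congr1 (fun f => f i) vw).
Qed.

Lemma coordsK : cancel coords to_sphere.
Proof.
move=> w; apply: coords_inj; rewrite coords_to_sphere; last exact: coords_neq0.
by rewrite normalize2_id // sum_sqr_coords.
Qed.

Lemma coords_sphere_pt : coords (sphere_pt R n) = fun i => (i == ord0)%:R.
Proof. by apply/funext => i; rewrite /coords /= mxE; case: eqP. Qed.

Lemma to_sphere_scale (c : R) z :
  0 < c -> to_sphere (fun i => c * z i) = to_sphere z.
Proof. by move=> c0; rewrite /to_sphere normalize2_scale. Qed.

Lemma coords_continuous i : continuous (fun w => coords w i).
Proof.
move=> w; apply: (@continuous_comp _ _ _ set_val (fun M : 'rV[R]_n.+1 => M ord0 i)).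
  exact: continuous_set_val.
exact: coord_continuous.
Qed.

Lemma to_sphere_continuous {T : topologicalType} (F : T -> 'I_n.+1 -> R) :
  (forall x, exists i, F x i != 0) -> (forall i, continuous (F^~ i)) ->
  continuous (fun x => to_sphere (F x)).
Proof.
move=> F0 cF; apply: continuous_set_type; apply: continuous_row => i.
have -> : (fun x => set_val (to_sphere (F x)) ord0 i) =
          (fun x => normalize2 (F x) i).
  by apply/funext => x; rewrite -coords_to_sphere.
exact: normalize2_continuous.
Qed.

Lemma closed_sphere_pt : closed [set sphere_pt R n].
Proof.
have -> : [set sphere_pt R n] =
    \bigcap_i (fun w => coords w i) @^-1` [set (i == ord0)%:R].
  apply/seteqP; split=> [w -> i _ /=|w wE]; first by rewrite coords_sphere_pt.
  apply: coords_inj; rewrite coords_sphere_pt; apply/funext => i.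
  exact: wE.
apply: closed_bigI => i _; apply: closed_comp => [w _|].
  exact: coords_continuous.
exact: closed_eq.
Qed.

End SphereCoordinates.

(** * The join of the fibres of [pi], its spheres, and its flow *)

Section Join.
Context {R : realType} {E : finType} {n : nat}.
Variables (pi : E -> 'I_n.+1) (a : 'I_n.+1 -> E).
Hypothesis pia : forall i, pi (a i) = i.

Definition join_set : set (prod_topology (fun _ : E => (R : topologicalType))) :=
  [set x | (forall e, 0 <= x e) /\ \sum_e x e = 1 /\
     forall e e', pi e = pi e' -> x e != 0 -> x e' != 0 -> e = e'].

Implicit Types (x : E -> R) (y : 'I_n.+1 -> R) (s : 'I_n.+1 -> E).

(* Coordinates of [x], with the sign given by [P]; at most one term is nonzero
   on the join. *)
Definition signed (P : pred E) x (i : 'I_n.+1) : R :=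
  \sum_(e | pi e == i) (if P e then x e else - x e).

(** Such an [s] indexes one sphere of the wedge: [a i] and [s i] are the opposite vertices on axis
    [i]. *)
Definition avoiding s := forall i, pi (s i) = i /\ s i != a i.

(** If [x] vanishes on the whole fibre, [a i] is the witness, so later computations treat both cases
    alike. *)
Lemma join_fiber x (i : 'I_n.+1) : join_set x ->
  exists2 e0, pi e0 = i & forall e, pi e = i -> e != e0 -> x e = 0.
Proof.
move=> [_ [_ xinj]].
have [[e [pe xe]]|/forallNP N] := pselect (exists e, pi e = i /\ x e != 0).
  exists e => // e' pe' ne; apply/eqP/negPn/negP => xe'.
  by move/eqP: ne; apply; apply: xinj => //; rewrite pe.
exists (a i) => // e pe _; apply/eqP/negPn/negP => xe.
by apply: (N e).
Qed.

Lemma sum_fiber (F : E -> R) (i : 'I_n.+1) e0 : pi e0 = i ->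
  (forall e, pi e = i -> e != e0 -> F e = 0) ->
  \sum_(e | pi e == i) F e = F e0.
Proof.
move=> pe0 F0; rewrite (bigD1 e0) /= ?pe0 // big1 ?addr0 // => e /andP[/eqP].
exact: F0.
Qed.

Lemma signedE (P : pred E) x i e0 : pi e0 = i ->
  (forall e, pi e = i -> e != e0 -> x e = 0) ->
  signed P x i = if P e0 then x e0 else - x e0.
Proof.
move=> pe0 x0; rewrite /signed (sum_fiber pe0) // => e pe ne.
by rewrite x0 // oppr0 if_same.
Qed.

Lemma signedZ (P : pred E) (c : R) x :
  signed P (fun e => c * x e) = fun i => c * signed P x i.
Proof.
apply/funext => i; rewrite /signed mulr_sumr; apply: eq_bigr => e _.
by case: ifP; rewrite ?mulrN.
Qed.

(** Each fibre carries at most one nonzero term, so signs cause no cancellation: signed coordinates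
    lie on the boundary of the cross-polytope. *)
Lemma sum_norm_signed (P : pred E) x : join_set x ->
  \sum_i `|signed P x i| = 1.
Proof.
move=> Xx; have [x0 [x1 _]] := Xx; rewrite -[RHS]x1.
rewrite (partition_big pi predT) //=; apply: eq_bigr => i _.
have [e0 pe0 H] := join_fiber i Xx.
rewrite (signedE _ pe0) // (sum_fiber pe0) //.
by case: ifP => _; rewrite ?normrN ger0_norm.
Qed.

Lemma join_normalize1 x : (forall e, 0 <= x e) -> (exists e, x e != 0) ->
  (forall e e', pi e = pi e' -> x e != 0 -> x e' != 0 -> e = e') ->
  join_set (normalize1 x).
Proof.
move=> x0 xn xinj; have xp := sum_norm_gt0 xn.
split; [|split] => [e||e e' pe].
- by rewrite divr_ge0 // ltW.
- rewrite -[RHS](sum_norm_normalize1 xn); apply: eq_bigr => e _.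
  by rewrite ger0_norm // divr_ge0 // ltW.
- by rewrite !mulf_eq0 !negb_or => /andP[xe _] /andP[xe' _]; exact: xinj.
Qed.

(** The inclusion of the cross-polytope of [s] into the join, up to normalization: positive parts go
    to [a i], negative parts to [s i]. *)
Definition lift s y (e : E) : R :=
  if e == a (pi e) then Num.max 0 (y (pi e))
  else if e == s (pi e) then Num.max 0 (- y (pi e)) else 0.

Lemma lift_ge0 s y e : 0 <= lift s y e.
Proof. by rewrite /lift; do 2?case: ifP => _; rewrite ?le_max ?lexx. Qed.

Lemma liftZ s (c : R) y : 0 < c ->
  lift s (fun i => c * y i) = fun e => c * lift s y e.
Proof.
move=> c0; apply/funext => e; rewrite /lift -mulrN -[X in Num.max X](mulr0 c).
by rewrite -!maxr_pMr ?ltW // mulr0; do 2?case: ifP => _; rewrite ?mulr0.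
Qed.

Lemma lift1 s : lift s (fun=> 1) = fun e => (e == a (pi e))%:R.
Proof.
apply/funext => e; rewrite /lift; case: ifP => _; first exact/max_idPr/ler01.
by case: ifP => // _; apply/max_idPl; rewrite oppr_le0 ler01.
Qed.

Lemma lift_neq0 s y : avoiding s -> (exists i, y i != 0) ->
  exists e, lift s y e != 0.
Proof.
move=> sa [i yi]; have [ps ns] := sa i; have [y0|y0] := ltP 0 (y i).
  by exists (a i); rewrite /lift pia eqxx max_r ?ltW // gt_eqF.
exists (s i); rewrite /lift ps (negPf ns) eqxx max_r ?oppr_ge0 //.
by rewrite oppr_eq0.
Qed.

(** The positive and the negative part of a real number are never both nonzero. *)
Lemma lift_inj s y e e' :
  pi e = pi e' -> lift s y e != 0 -> lift s y e' != 0 -> e = e'.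
Proof.
move=> pe; rewrite /lift -pe.
have L (z : R) : Num.max 0 z != 0 -> 0 < z.
  by case: (ltP 0 z) => // _; rewrite eqxx.
have N (z : R) : 0 < z -> 0 < - z -> False by lra.
have [ea|_] := eqVneq e (a (pi e)); have [ea'|_] := eqVneq e' (a (pi e)).
- by move=> _ _; rewrite ea'.
- by have [_ /L /N p /L /p|_ _] := eqVneq e' (s (pi e)); rewrite ?eqxx.
- by have [_ /L h /L /N /(_ h)|_] := eqVneq e (s (pi e)); rewrite ?eqxx.
- have [es|_] := eqVneq e (s (pi e)); last by rewrite eqxx.
  by have [-> _ _|_ _] := eqVneq e' (s (pi e)); last by rewrite eqxx.
Qed.

Lemma join_lift s y : avoiding s -> (exists i, y i != 0) ->
  join_set (normalize1 (lift s y)).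
Proof.
move=> sa y0; apply: join_normalize1; first exact: lift_ge0.
- exact: lift_neq0.
- exact: lift_inj.
Qed.

(** With these signs, [signed] folds the join onto the cross-polytope of [s]: every edge of a fibre
    other than [s i] goes to the positive vertex. *)
Definition off s : pred E := [pred e | e != s (pi e)].

Lemma signed_lift s y : avoiding s -> signed (off s) (lift s y) = y.
Proof.
move=> sa; apply/funext => i; have [ps ns] := sa i.
rewrite /signed (bigD1 (a i)) ?pia //= (bigD1 (s i)) /=; last first.
  by rewrite ps eqxx.
rewrite big1 => [|e /andP[/andP[/eqP pe ea] es]].
  have na : (a i == s i) = false by rewrite eq_sym (negPf ns).
  rewrite /off /lift /= !pia ps !eqxx (negPf ns) na /= addr0.
  have /orP[y0|y0] := le_total 0 (y i).
    by rewrite (max_r y0) max_l ?oppr_le0 // oppr0 addr0.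
  by rewrite (max_l y0) max_r ?oppr_ge0 // opprK add0r.
by rewrite /lift pe (negPf ea) (negPf es) oppr0 if_same.
Qed.

Lemma signed_off_ge0 s x i : (forall e, 0 <= x e) -> x (s i) = 0 ->
  0 <= signed (off s) x i.
Proof.
move=> x0 xs; apply: sumr_ge0 => e /eqP pe; rewrite /off /= pe.
by case: eqP => [->|_] /=; rewrite ?xs ?oppr0.
Qed.

(** The left side is a positive multiple of [y] and has norm 1 by [sum_norm_signed]. *)
Lemma signed_normalize1_lift s y : avoiding s -> (exists i, y i != 0) ->
  signed (off s) (normalize1 (lift s y)) = normalize1 y.
Proof.
move=> sa y0; have := sum_norm_signed (off s) (join_lift sa y0).
have [c c0 ->] := normalize1E (lift_neq0 sa y0).
rewrite signedZ signed_lift // => /normalize1_id <-.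
by rewrite normalize1_scale.
Qed.

(** Signs independent of [s]; on the sphere of an avoiding [s] they give the same coordinates as
    [off s]. *)
Definition base : pred E := [pred e | e == a (pi e)].

(* The push read on the join: positive coordinates live on the edges [a i] and
   the absolute values of the negative ones on the other edges, so the sphere
   containing [x] need not be chosen. *)
Definition shrink (t : R) x (e : E) : R :=
  let y := signed base x in
  if e == a (pi e) then Num.max 0 (push t y (pi e))
  else Num.max 0 ((1 - tilt t y) * x e - tilt t y).

Lemma shrink_ge0 t x e : 0 <= shrink t x e.
Proof. by rewrite /shrink; case: ifP => _; rewrite le_max lexx. Qed.

(** Some pushed coordinate is nonzero. If positive, it survives on [a i]. If negative, it comes from
    an edge other than [a i], where [shrink] takes its absolute value. *)
Lemma shrink_neq0 t x : 0 <= t <= 1 -> join_set x ->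
  exists e, shrink t x e != 0.
Proof.
move=> t01 Xx; have [i] := push_neq0 t01 (sum_norm_signed base Xx).
set y := signed base x => pn0; have [/andP[t0 _] T1] := (t01, tilt_le1 y t01).
have [p0|p0] := ltP 0 (push t y i).
  by exists (a i); rewrite /shrink pia eqxx max_r ?ltW // gt_eqF.
have {}p0 : push t y i < 0 by rewrite lt_neqAle pn0.
have [e0 pe0 H] := join_fiber i Xx.
have yE : y i = if e0 == a i then x e0 else - x e0.
  by rewrite /y (signedE _ pe0 H) /base /= pe0.
move: yE; case: ifP => e0a yE; move: p0; rewrite /push yE => p0.
  have : 0 <= (1 - tilt t y) * x e0.
    by rewrite mulr_ge0 ?subr_ge0 //; exact: Xx.1.
  by have := tilt_ge0 y t0; lra.
exists e0; rewrite /shrink pe0 e0a -/y; rewrite max_r; last by lra.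
by rewrite gt_eqF //; lra.
Qed.

(** Edges other than [a i] can only leave the support. The edge [a i] may enter it, but only when
    the pushed coordinate is positive, and then the other edge of the fibre has left. *)
Lemma shrink_inj t x e e' : 0 <= t <= 1 -> join_set x ->
  pi e = pi e' -> shrink t x e != 0 -> shrink t x e' != 0 -> e = e'.
Proof.
move=> t01 Xx; have [/andP[t0 _] T1] := (t01, tilt_le1 (signed base x) t01).
have T0 := tilt_ge0 (signed base x) t0; have [x0 [_ xinj]] := Xx.
rewrite /shrink; set y := signed base x in T1 T0 *.
have L (z : R) : Num.max 0 z != 0 -> 0 < z.
  by case: (ltP 0 z) => // _; rewrite eqxx.
have xn0 e1 : 0 < (1 - tilt t y) * x e1 - tilt t y -> x e1 != 0.
  by move=> H; apply/eqP => x10; move: H; rewrite x10; lra.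
(* Otherwise the same pushed coordinate would be both positive and negative. *)
have K e1 e2 : pi e1 = pi e2 -> e1 == a (pi e1) -> e2 != a (pi e2) ->
    0 < push t y (pi e1) -> 0 < (1 - tilt t y) * x e2 - tilt t y -> False.
  move=> p12 /eqP ea1 ea2 P1 P2; have xe2 := xn0 _ P2.
  have yE : y (pi e1) = - x e2.
    rewrite /y (@signedE _ _ _ e2) /base /= ?(negPf ea2) // => e3 p3 n3.
    apply/eqP/negPn/negP => xe3; move/eqP: n3; apply; apply: xinj => //.
    by rewrite p3.
  by move: P1; rewrite /push yE; lra.
move=> pe; case: ifP => ea; case: ifP => ea' /L P1 /L P2.
- by rewrite (eqP ea) (eqP ea') pe.
- by case: (K e e') => //; rewrite ea'.
- by case: (K e' e) => //; rewrite ea.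
- by apply: xinj => //; exact: xn0.
Qed.

Definition flow (t : R) x : E -> R := normalize1 (shrink t x).

Lemma join_flow t x : 0 <= t <= 1 -> join_set x -> join_set (flow t x).
Proof.
move=> t01 Xx; apply: join_normalize1; first exact: shrink_ge0.
- exact: shrink_neq0.
- by move=> e e'; exact: shrink_inj.
Qed.

Lemma flow0 x : join_set x -> flow 0 x = x.
Proof.
move=> Xx; have [x0 [x1 xinj]] := Xx.
suff -> : flow 0 x = normalize1 x.
  by apply: normalize1_id; rewrite -[RHS]x1; apply: eq_bigr => e _; rewrite ger0_norm.
congr normalize1; apply/funext => e; rewrite /shrink push0 tilt0 !subr0 mul1r.
case: eqP => [ea|_]; last exact: max_r.
have [e0 pe0 H] := join_fiber (pi e) Xx; rewrite (signedE _ pe0 H) /base /= pe0 -ea.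
have [->|ne] := eqVneq e0 e; first exact: max_r.
by rewrite max_l ?oppr_le0 // H // eq_sym.
Qed.

(** Fold onto the cross-polytope of [s], collapse all but its open negative orthant, and move to the
    round sphere. *)
Definition to_factor s x : sphere R n :=
  to_sphere (unshear (push 1 (signed (off s) x))).

(** [shear] places the base point at the barycentre of the simplex on the [a i], which all these
    spheres share. *)
Definition of_factor s (w : sphere R n) : E -> R :=
  normalize1 (lift s (shear (coords w))).

Definition sphere_flow (t : R) (w : sphere R n) : sphere R n :=
  to_sphere (unshear (push t (normalize1 (shear (coords w))))).

Lemma to_sphere_unshear1 (c : R) : 0 < c ->
  to_sphere (unshear (fun=> c)) = sphere_pt R n.
Proof.
move=> c0; have -> : (fun=> c) = (fun i : 'I_n.+1 => c * 1).
  by apply/funext => i; rewrite mulr1.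
by rewrite unshearZ to_sphere_scale // unshear1 -coords_sphere_pt coordsK.
Qed.

(** The base point lies in the direction of the push, so it only gets rescaled. This lets the flows
    of the spheres glue on the wedge. *)
Lemma sphere_flow_pt t : 0 <= t <= 1 ->
  sphere_flow t (sphere_pt R n) = sphere_pt R n.
Proof.
move=> t01; have /andP[t0 _] := t01.
rewrite /sphere_flow coords_sphere_pt shear_delta.
have H1 : exists i : 'I_n.+1, (1 : R) != 0 by exists ord0; rewrite oner_eq0.
have [c c0 ->] := normalize1E H1.
apply: to_sphere_unshear1; have := @tilt_ge0 _ n t (fun=> c * 1) t0.
have := @tilt_le1 _ n t (fun=> c * 1) t01.
rewrite mulr1; set u := tilt _ _; rewrite le_eqVlt => /predU1P[->|u1 u0].
  by rewrite subrr mul0r add0r.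
by rewrite ltr_pwDl // mulr_gt0 // subr_gt0.
Qed.

Lemma sphere_flow0 w : sphere_flow 0 w = w.
Proof.
rewrite /sphere_flow push0.
have [c c0 ->] := normalize1E (shear_neq0 (coords_neq0 w)).
by rewrite unshearZ to_sphere_scale // shearK coordsK.
Qed.

Lemma to_factor_of_factor s w : avoiding s ->
  to_factor s (of_factor s w) = sphere_flow 1 w.
Proof.
move=> sa; rewrite /to_factor /of_factor signed_normalize1_lift //.
exact/shear_neq0/coords_neq0.
Qed.

Lemma join_of_factor s w : avoiding s -> join_set (of_factor s w).
Proof. by move=> sa; apply: join_lift => //; exact/shear_neq0/coords_neq0. Qed.

(** Without weight on [s i], the folded coordinate [i] is nonnegative and [push1] applies. *)
Lemma to_factor_pt s x i : (forall e, 0 <= x e) -> x (s i) = 0 ->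
  to_factor s x = sphere_pt R n.
Proof.
move=> x0 xs; rewrite /to_factor (push1 (signed_off_ge0 x0 xs)).
exact: to_sphere_unshear1.
Qed.

Lemma to_factor_of_factor_neq s s' w i : avoiding s -> avoiding s' ->
  s' i != s i -> to_factor s' (of_factor s w) = sphere_pt R n.
Proof.
move=> sa sa' ne; apply: (@to_factor_pt _ _ i).
  by have [] := join_of_factor w sa.
have [ps ns] := sa' i.
by rewrite /of_factor /normalize1 /lift ps (negPf ns) (negPf ne) mul0r.
Qed.

Lemma of_factor_pt s s' :
  of_factor s (sphere_pt R n) = of_factor s' (sphere_pt R n).
Proof. by rewrite /of_factor coords_sphere_pt shear_delta !lift1. Qed.

(** Were all coordinates negative, the support of [x] would be an avoiding choice, against the
    hypothesis. So [push1] applies, and the limit depends on [a] alone. *)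
Lemma flow1_pt s x : join_set x ->
  (forall s', avoiding s' -> exists i, x (s' i) = 0) ->
  flow 1 x = of_factor s (sphere_pt R n).
Proof.
move=> Xx H; rewrite /of_factor coords_sphere_pt shear_delta lift1.
have [i yi] : exists i, 0 <= signed base x i.
  apply: contrapT => /forallNP N.
  have {}N i : signed base x i < 0 by rewrite real_ltNge ?num_real //; exact/negP.
  have /choice[s' s'P] : forall i, exists e, [/\ pi e = i, e != a i & x e != 0].
    move=> i; have [e0 pe0 He0] := join_fiber i Xx; exists e0.
    have := N i; rewrite (signedE _ pe0 He0) /base /= pe0.
    have x0 := Xx.1 e0; case: ifP => _ ; first by rewrite real_ltNge ?num_real // x0.
    by split => //; rewrite gt_eqF //; lra.
  have [i|i] := H s'; first by have [] := s'P i.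
  by have [_ _ /eqP] := s'P i.
congr normalize1; apply/funext => e.
rewrite /shrink (push1 yi) (tilt1 yi) subrr mul0r add0r.
case: eqP => _; first exact/max_r/ler01.
by rewrite max_l // oppr_le0 ler01.
Qed.

(** The support of [x] is exactly the image of [s], so [off s] and [base] give the same coordinates;
    the intermediate normalizations are positive factors and cancel. *)
Lemma flow1_to_factor s x : join_set x -> avoiding s ->
  (forall i, x (s i) != 0) -> flow 1 x = of_factor s (to_factor s x).
Proof.
move=> Xx sa xs; have [x0 [_ xinj]] := Xx.
have H i e : pi e = i -> e != s i -> x e = 0.
  move=> pe ne; apply/eqP/negPn/negP => xe; move/eqP: ne; apply.
  by apply: xinj => //; have [-> _] := sa i.
have sE : signed (off s) x = signed base x.
  apply/funext => i; have [ps ns] := sa i.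
  by rewrite !(signedE _ ps (@H i)) /off /base /= ps eqxx (negPf ns).
have p0 : exists i, push 1 (signed (off s) x) i != 0.
  by apply: push_neq0; rewrite ?ler01 ?lexx //; exact: sum_norm_signed.
rewrite /of_factor /to_factor coords_to_sphere; last exact: unshear_neq0.
have [c c0 ->] := normalize2E (unshear_neq0 p0).
rewrite shearZ unshearK liftZ // normalize1_scale // /flow sE.
congr normalize1; apply/funext => e; rewrite /shrink /lift.
case: eqP => // _; case: eqP => [es|/eqP es].
  have [ps ns] := sa (pi e).
  rewrite /push (signedE _ ps (@H (pi e))) /base /= ps (negPf ns) -es.
  by congr Num.max; ring.
(* On the remaining edges [x e = 0], and [- tilt] is cut off to 0. *)
rewrite (@H (pi e)) // mulr0 add0r max_l // oppr_le0.
by apply: tilt_ge0; exact: ler01.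
Qed.

End Join.

(** * Gluing maps into a wedge when at most one is away from the base point *)

Section WedgeGlue.
Context {k : nat} {S T : topologicalType} (p : S).
Variable F : 'I_k -> T -> S.
Hypothesis cF : forall j, continuous (F j).
Hypothesis Fp : forall x, exists j, forall j', j' != j -> F j' x = p.
Hypothesis clp : closed [set p].

Local Notation W := (@wedge _ (fun _ : 'I_k => S) (fun _ => p)).
Let inW (j : 'I_k) : S -> W :=
  @wedge_lift _ (fun _ : 'I_k => S) (fun _ => p) j.

Definition wedge_glue (x : T) : W :=
  inW (projT1 (cid (Fp x))) (F (projT1 (cid (Fp x))) x).

(** The chosen index is immaterial: if two different ones qualify, both values are [p], and the
    copies of [p] are identified. *)
Lemma wedge_glueE x j : (forall j', j' != j -> F j' x = p) ->
  wedge_glue x = inW j (F j x).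
Proof.
move=> H; rewrite /wedge_glue; case: cid => j0 /= H0.
have [->//|ne] := eqVneq j0 j.
rewrite (H j0 ne) (H0 j); last by rewrite eq_sym.
exact: (@wedge_liftE _ (fun _ : 'I_k => S) (fun _ => p) j p j0 p).
Qed.

(* The sets where all [F j'] but one are at the base point form a finite closed
   cover. *)
Lemma wedge_glue_continuous : continuous wedge_glue.
Proof.
apply/continuous_closedP => A clA.
have -> : wedge_glue @^-1` A =
    \bigcup_(j in [set: 'I_k]) ((inW j \o F j) @^-1` A `&`
      \bigcap_(j' in [set j' | j' != j]) (F j' @^-1` [set p])).
  apply/seteqP; split=> [x Ax|x [j _ [/= Ax /= H]]] /=.
    have [j H] := Fp x; exists j => //; split => [|j' /H//].
    by rewrite /= -wedge_glueE.
  by rewrite (@wedge_glueE x j).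
rewrite -bigsetU_fset_set; last exact: finite_finset.
apply: closed_bigsetU => j _; apply: closedI.
  apply: closed_comp => // x _; apply: continuous_comp; first exact: cF.
  exact: wedge_lift_continuous.
apply: closed_bigI => j' _; apply: closed_comp => // x _; exact: cF.
Qed.

End WedgeGlue.

(** * The homotopy equivalence between the join and the wedge *)

Section JoinHomotopy.
Context {R : realType} {E : finType} {n : nat}.
Variables (pi : E -> 'I_n.+1) (a : 'I_n.+1 -> E).
Hypothesis pia : forall i, pi (a i) = i.

Section Continuity.
Context {T : topologicalType} (F : T -> E -> R).
Hypothesis cF : forall e, continuous (F^~ e).

Lemma signed_continuous (P : pred E) i :
  continuous (fun x => signed pi P (F x) i).
Proof.
apply: continuous_sumr => e; case: (P e); first exact: cF.
by apply: continuousNr; exact: cF.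
Qed.

Lemma lift_continuous (y : T -> 'I_n.+1 -> R) s e :
  (forall i, continuous (y^~ i)) -> continuous (fun x => lift pi a s (y x) e).
Proof.
move=> cy; rewrite /lift; case: (e == _).
  by apply: continuous_maxr; [exact: continuous_cstr|exact: cy].
case: (e == _); last exact: continuous_cstr.
by apply: continuous_maxr; [exact: continuous_cstr|apply: continuousNr; exact: cy].
Qed.

Lemma shrink_continuous (t : T -> R) e :
  continuous t -> continuous (fun x => shrink pi a (t x) (F x) e).
Proof.
move=> ct; have cs := @signed_continuous (base pi a).
have cu := tilt_continuous ct cs; rewrite /shrink /=; case: (e == _).
  by apply: continuous_maxr; [exact: continuous_cstr|exact: push_continuous].
apply: continuous_maxr; first exact: continuous_cstr.
apply: continuousDr; last exact: continuousNr.
apply: continuousMr; last exact: cF.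
by apply: continuousDr; [exact: continuous_cstr|exact: continuousNr].
Qed.

End Continuity.

Definition join : topologicalType := set_type (@join_set R E n pi).

Definition bary (x : join) : E -> R := set_val x.

Lemma join_bary x : join_set pi (bary x).
Proof. exact: (set_mem (valP x)). Qed.

Definition to_join (x : E -> R) (Xx : join_set pi x) : join :=
  SigSub (mem_set Xx).

Lemma bary_continuous e : continuous (fun x : join => bary x e).
Proof.
move=> x; apply: (@continuous_comp _ _ _ (set_val : join -> _)
  (fun f : prod_topology (fun _ : E => (R : topologicalType)) => f e)).
  exact: continuous_set_val.
exact: proj_continuous.
Qed.

Lemma to_join_continuous {T : topologicalType} (F : T -> E -> R)
    (XF : forall x, join_set pi (F x)) :
  (forall e, continuous (F^~ e)) -> continuous (fun x => to_join (XF x)).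
Proof.
by move=> cF; apply: continuous_set_type; exact: continuous_prod_topology.
Qed.

(** Time is reversed because the flows start at the identity, whereas the required homotopies end
    there. *)
Lemma unit_rev (t : unit_interval R) : 0 <= 1 - sval t <= 1.
Proof.
have /andP[t0 t1] := set_mem (valP t).
by rewrite subr_ge0 gerBl; apply/andP; split.
Qed.

Lemma unit_rev_continuous :
  continuous (fun t : unit_interval R => 1 - sval t : R).
Proof.
apply: continuousDr; first exact: continuous_cstr.
by apply: continuousNr; exact: continuous_set_val.
Qed.

Lemma homotopic_flow (g : join -> join) :
  (forall x, bary (g x) = flow pi a 1 (bary x)) -> homotopic R join join g idfun.
Proof.
move=> gE.
exists (fun p => to_join (join_flow pia (unit_rev p.2) (join_bary p.1))).
split; [|split] => [|x t t0|x t t1].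
- apply: to_join_continuous => e; apply: normalize1_continuous.
    by move=> p; exact: shrink_neq0 (unit_rev p.2) (join_bary p.1).
  move=> e'; apply: shrink_continuous.
    move=> e'' p; apply: (@continuous_comp _ _ _ fst (fun x => bary x e'')).
      exact: cvg_fst.
    exact: bary_continuous.
  move=> p; apply: (@continuous_comp _ _ _ snd
    (fun t : unit_interval R => 1 - sval t : R)); first exact: cvg_snd.
  exact: unit_rev_continuous.
- by apply/val_inj; rewrite /= t0 subr0 -gE.
- apply/val_inj; rewrite /= t1 subrr; apply: (flow0 pia); exact: join_bary.
Qed.

(** Holds for arbitrary [s], so the base point is available even when no choice is avoiding. *)
Lemma join_of_factor_pt s : join_set pi (of_factor pi a s (sphere_pt R n)).
Proof.
rewrite /of_factor coords_sphere_pt shear_delta lift1.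
apply: join_normalize1 => [e|| e e' pe]; first exact: ler0n.
  by exists (a ord0); rewrite pia eqxx oner_eq0.
have [ea _|_] := eqVneq e (a (pi e)); last by rewrite eqxx.
have [ea' _|_] := eqVneq e' (a (pi e')); last by rewrite eqxx.
by rewrite ea' -pe.
Qed.

(** With no avoiding choice, [flow1_pt] applies at every point and the flow is a contraction. *)
Lemma join_contractible : (forall s, ~ avoiding pi a s) ->
  homotopy_equivalent R join (point_space R).
Proof.
move=> N.
exists (fun=> SigSub (mem_set (erefl : [set (0 : R)] 0))).
exists (fun=> to_join (join_of_factor_pt a)).
split; first by move=> x; apply: cst_continuous.
split; first by move=> x; apply: cst_continuous.
split; first apply: homotopic_flow => x.
  rewrite (flow1_pt pia a (join_bary x)) // => s /N[].
exists fst; split; first by move=> x; exact: cvg_fst.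
by split => // -[x x0] t _; apply/val_inj; rewrite /= (set_mem x0).
Qed.

Lemma sphere_flow_continuous :
  continuous (fun p : (unit_interval R * sphere R n)%type =>
    sphere_flow (1 - sval p.1) p.2).
Proof.
have cy i : continuous (fun p : (unit_interval R * sphere R n)%type =>
    normalize1 (shear (coords p.2)) i).
  apply: normalize1_continuous => [p|j].
    exact/shear_neq0/coords_neq0.
  apply: shear_continuous => {}j p.
  apply: (@continuous_comp _ _ _ snd (fun w => coords w j)).
    exact: cvg_snd.
  exact: coords_continuous.
apply: to_sphere_continuous => [p|i].
  apply/unshear_neq0/push_neq0; first exact: unit_rev.
  exact/sum_norm_normalize1/shear_neq0/coords_neq0.
apply: unshear_continuous => {}i; apply: push_continuous => // p.
apply: (@continuous_comp _ _ _ fst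
  (fun t : unit_interval R => 1 - sval t : R)); first exact: cvg_fst.
exact: unit_rev_continuous.
Qed.

Lemma to_factor_continuous s :
  continuous (fun x : join => to_factor pi s (bary x)).
Proof.
have cs i : continuous (fun x : join => signed pi (off pi s) (bary x) i).
  by apply: signed_continuous; exact: bary_continuous.
apply: to_sphere_continuous => [x|i].
  apply/unshear_neq0/push_neq0; first by rewrite ler01 lexx.
  exact/sum_norm_signed/join_bary.
apply: unshear_continuous => {}i; apply: push_continuous => //.
exact: continuous_cstr.
Qed.

Lemma of_factor_continuous s e : avoiding pi a s ->
  continuous (fun w : sphere R n => of_factor pi a s w e).
Proof.
move=> sa; apply: normalize1_continuous => [w|e'].
  by apply: lift_neq0 => //; exact/shear_neq0/coords_neq0.
apply: lift_continuous => i; apply: shear_continuous.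
exact: coords_continuous.
Qed.

Lemma join_wedge (k : nat) (s : 'I_k -> 'I_n.+1 -> E) : (0 < k)%N ->
  (forall j, avoiding pi a (s j)) ->
  (forall j j', j != j' -> exists i, s j i != s j' i) ->
  (forall s', avoiding pi a s' -> exists j, s j =1 s') ->
  homotopy_equivalent R join (wedge_spheres R k n).
Proof.
move=> k0 sa sinj ssurj.
pose inW := @wedge_lift _ (fun _ : 'I_k => sphere R n) (fun _ => sphere_pt R n).
pose F j (x : join) := to_factor pi (s j) (bary x).
(* The open negative orthants are disjoint: [x] lies in that of one [s j], or in none and then all
   factors are at the base point. *)
have Fcase x : exists j, (forall j', j' != j -> F j' x = sphere_pt R n) /\
    flow pi a 1 (bary x) = of_factor pi a (s j) (F j x).
  have Xx := join_bary x; have [x0 [_ xinj]] := Xx.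
  have [[j xj]|/forallNP N] := pselect (exists j, forall i, bary x (s j i) != 0).
    exists j; split; last exact: flow1_to_factor.
    move=> j' /sinj[i ne]; apply: (@to_factor_pt _ _ _ _ _ _ i) => //.
    apply/eqP/negPn/negP => xj'; move/eqP: ne; apply; apply: xinj => //.
    by have [-> _] := sa j i; have [-> _] := sa j' i.
  have {}N s' : avoiding pi a s' -> exists i, bary x (s' i) = 0.
    move=> /ssurj[j sj]; have := N j; rewrite -existsNE => -[i /negP/negPn/eqP].
    by rewrite sj; exists i.
  have Fx j : F j x = sphere_pt R n.
    by have [i xi] := N _ (sa j); exact: to_factor_pt xi.
  (* Any index would do here; [0 < k] provides one. *)
  exists (Ordinal k0); split=> [j' _|]; rewrite Fx //.
  exact: flow1_pt.
have Fp x : exists j, forall j', j' != j -> F j' x = sphere_pt R n.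
  by have [j [H _]] := Fcase x; exists j.
pose f : join -> wedge_spheres R k n := wedge_glue Fp.
pose G j w := to_join (join_of_factor pia w (sa j)).
pose g : wedge_spheres R k n -> join := wedge_fun G.
have Gpt i j : G i (sphere_pt R n) = G j (sphere_pt R n).
  by apply/val_inj => /=; exact: of_factor_pt.
have gE j w : g (inW j w) = G j w by exact: wedge_lift_funE.
exists f, g; split.
  apply: wedge_glue_continuous; last exact: closed_sphere_pt.
  by move=> j; exact: to_factor_continuous.
split.
  apply: wedge_fun_continuous => // j.
  by apply: to_join_continuous => e; exact: of_factor_continuous.
split.
  apply: homotopic_flow => x; have [j [H ->]] := Fcase x.
  by rewrite /f /= (wedge_glueE _ H) gE.
pose K (j : 'I_k) (t : unit_interval R) (w : sphere R n) :=
  inW j (sphere_flow (1 - sval t) w).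
have Kpt t i j : K i t (sphere_pt R n) = K j t (sphere_pt R n).
  rewrite /K !sphere_flow_pt ?unit_rev //.
  exact: (@wedge_liftE _ (fun _ : 'I_k => sphere R n) (fun _ => sphere_pt R n)
    j (sphere_pt R n) i (sphere_pt R n)).
have KE j t w : wedge_fun (K^~ t) (inW j w) = K j t w by exact: wedge_lift_funE.
have Wcase w : exists j v, w = inW j v.
  have : [set: wedge_spheres R k n] w by [].
  by rewrite -wedgeTE => -[j _ [v _ <-]]; exists j, v.
exists (fun p => wedge_fun (K^~ p.2) p.1).
split; [|split] => [|w t t0|w t t1].
(* The swap puts the time parameter first, as [wedge_fun_joint_continuous] expects. *)
- move=> p; apply: (@continuous_comp _ _ _
    (fun p : wedge_spheres R k n * unit_interval R => (p.2, p.1))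
    (uncurry (fun t => wedge_fun (K^~ t)))); first exact: swap_continuous.
  apply: wedge_fun_joint_continuous => //.
  + exact: finite_finset.
  + by move=> _; exact: closed_sphere_pt.
  + move=> j; have -> : uncurry (K j) =
        inW j \o (fun p => sphere_flow (1 - sval p.1) p.2).
      by apply/funext => -[].
    move=> q; apply: continuous_comp; first exact: sphere_flow_continuous.
    exact: wedge_lift_continuous.
(* On the sphere of [s j] every other factor is constant, since another choice uses some edge
   missing there. *)
- have [j [v ->]] := Wcase w; rewrite [LHS]KE /K t0 subr0 /= gE /f.
  rewrite (@wedge_glueE _ _ _ _ _ _ _ j) /F ?to_factor_of_factor //.
  by move=> j' /sinj[i ne]; exact: to_factor_of_factor_neq ne.
- by have [j [v ->]] := Wcase w; rewrite [LHS]KE /K t1 subrr sphere_flow0.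
Qed.

End JoinHomotopy.

(** * Directed forests of an acyclic graph as simplices of a join *)

Section DirectedForests.
Context {V : finType} {e : rel V}.

Lemma acyclic_sub (F : {set edge e}) :
  acyclic_rel e -> acyclic_rel (rel_of_edges e F).
Proof.
move=> ac v p vp; apply: ac; apply: sub_path vp => u w.
by case/existsP => x /andP[_ /eqP xE]; have := valP x; rewrite xE.
Qed.

(** Acyclicity is inherited from [e]; the bound on edges into each vertex becomes the injectivity
    condition of [join_set]. *)
Lemma directed_forestP (F : {set edge e}) : acyclic_rel e ->
  directed_forest e F <->
  {in F &, forall x y, (val x).2 = (val y).2 -> x = y}.
Proof.
move=> ac; split=> [[_ F1] x y xF yF xy|Finj].
  by apply: (card_le1_eqP (F1 (val x).2)); rewrite inE ?xF ?yF /= ?xy.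
split; first exact: acyclic_sub.
move=> v; apply/card_le1_eqP => x y; rewrite !inE.
by move=> /andP[xF /eqP xv] /andP[yF /eqP yv]; apply: Finj; rewrite ?xv.
Qed.

(* The set in the definition of [indeg] is a classical one. *)
Lemma indegE v : indeg e v = #|[pred x : edge e | (val x).2 == v]|.
Proof. by apply: eq_card => x; apply/idP/idP => [/set_mem|/mem_set]. Qed.

Lemma target_nonsource (x : edge e) : (val x).2 \in ~: sources e.
Proof.
rewrite !inE indegE -lt0n; apply/card_gt0P; exists x.
by rewrite inE.
Qed.

Context {R : realType}.

Lemma DT_realization_setE n (pi : edge e -> 'I_n.+1) : acyclic_rel e ->
  (forall x y, (pi x = pi y) <-> ((val x).2 = (val y).2)) ->
  DT_realization_set R e = join_set pi.
Proof.
move=> ac piE; apply/seteqP; split=> f [f0 [f1 H]]; split=> //; split=> //.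
  move=> x y /piE xy fx fy; move/(directed_forestP _ ac): H => H.
  by apply: H xy; rewrite inE.
apply/(directed_forestP _ ac) => x y; rewrite !inE => fx fy /piE xy.
exact: H.
Qed.

(** The target of an edge is never a source, so there are no edges, and an empty sum is not 1. *)
Lemma DT_empty : ~: sources e = finset.set0 ->
  homotopy_equivalent R (DT_realization R e) (empty_space R).
Proof.
move=> N0.
have noX (x : DT_realization R e) : False.
  have [_ [x1 _]] := set_mem (valP x); move: x1; rewrite big1.
    by move=> /esym/eqP; rewrite oner_eq0.
  by move=> y; have := target_nonsource y; rewrite N0 inE.
have noE (x : empty_space R) : False by have := set_mem (valP x).
exists (fun x => False_rect _ (noX x)), (fun x => False_rect _ (noE x)).
split; first by move=> x; case: (noX x).
split; first by move=> x; case: (noE x).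
split.
  exists fst; split; first by move=> x; case: (noX x.1).
  by split=> x; case: (noX x).
exists fst; split; first by move=> x; case: (noE x.1).
by split=> x; case: (noE x).
Qed.

End DirectedForests.

(** * Counting the spheres, and the conclusion *)

Lemma card_avoiding (E V : finType) n (tgt : E -> V) (v : 'I_n -> V)
    (a : 'I_n -> E) : (forall i, tgt (a i) = v i) ->
  #|family (fun i => [pred x | (tgt x == v i) && (x != a i)])| =
  (\prod_(i < n) (#|[pred x | tgt x == v i]| - 1))%N.
Proof.
move=> av; rewrite card_family foldrE big_map big_enum /=.
apply: eq_bigr => i _.
rewrite [in RHS](cardD1 (a i)) inE av eqxx addnC addnK.
by apply: eq_card => x; rewrite !inE andbC.
Qed.

Theorem theorem2p12 (R : realType) (V : finType) (e : rel V) :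
  acyclic_rel e ->
  htpy_wedge_of_spheres R (DT_realization R e)
    (\prod_(v in ~: sources e) (indeg e v - 1))%N
    (#|V|%:Z - #|sources e|%:Z - 1).
Proof.
move=> ac; set N := ~: sources e.
have dE : #|V|%:Z - #|sources e|%:Z - 1 = #|N|%:Z - 1.
  by rewrite -(cardsC (sources e)) PoszD; ring.
rewrite dE; case EN: #|N| => [|n].
  (* The empty product is 1 and the dimension is -1: the case of the empty space. *)
  move/eqP: EN; rewrite cards_eq0 => /eqP N0.
  by rewrite /htpy_wedge_of_spheres N0 big_set0 /=; exact: DT_empty.
(* [v] numbers the non-source vertices, and [pi] sends an edge to the number of its target. *)
pose v (i : 'I_n.+1) : V := enum_val (cast_ord (esym EN) i).
have vN i : v i \in N by exact: enum_valP.
pose pi (x : edge e) : 'I_n.+1 :=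
  cast_ord EN (enum_rank_in (target_nonsource x) (val x).2).
have vpi x : v (pi x) = (val x).2.
  by rewrite /v /pi cast_ordK enum_rankK_in // target_nonsource.
have v_inj : injective v by move=> i j /enum_val_inj/cast_ord_inj.
have piE x y : (pi x = pi y) <-> ((val x).2 = (val y).2).
  by rewrite -!vpi; split=> [->//|/v_inj].
have pi_eq x i : (pi x == i) = ((val x).2 == v i).
  by rewrite -vpi (inj_eq v_inj).
have /choice[a av] : forall i, exists x : edge e, (val x).2 = v i.
  move=> i; have := vN i; rewrite !inE indegE -lt0n => /card_gt0P[x].
  by rewrite inE => /eqP; exists x.
have pia i : pi (a i) = i by apply/eqP; rewrite pi_eq av.
pose Fam := family (fun i => [pred x : edge e | ((val x).2 == v i) && (x != a i)]).
have kE : (\prod_(u in N) (indeg e u - 1))%N = #|Fam|.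
  rewrite (@card_avoiding _ _ _ (fun x : edge e => (val x).2) v a av).
  rewrite big_enum_val /=.
  under eq_bigr do rewrite indegE.
  by rewrite (reindex (cast_ord (esym EN))) //=; exists (cast_ord EN) => i _;
     rewrite ?cast_ordK ?cast_ordKV.
have FamP (s : {ffun 'I_n.+1 -> edge e}) : s \in Fam <-> avoiding pi a s.
  split=> [/familyP sF i|sa].
    by have := sF i; rewrite inE => /andP[]; rewrite -pi_eq => /eqP.
  by apply/familyP => i; have [/eqP ps ns] := sa i; rewrite inE -pi_eq ps.
rewrite kE /htpy_wedge_of_spheres /DT_realization (DT_realization_setE ac piE).
case: eqP => [k0|/eqP k0].
  (* A zero product means that some non-source has only the edge [a i] into it, so no choice is
     avoiding. *)
  apply: (join_contractible pia) => s sa.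
  have := card0_eq k0 [ffun i => s i]; rewrite [RHS]inE => /negP; apply.
  by apply/FamP => i; rewrite ffunE.
have -> : n.+1%:Z - 1 = Posz n by rewrite -addn1 PoszD addrK.
pose s (j : 'I_#|Fam|) i := (enum_val j : {ffun 'I_n.+1 -> edge e}) i.
apply: (join_wedge pia (s := s)).
- by rewrite lt0n.
- by move=> j; apply/FamP; exact: enum_valP.
- move=> j j' jj'; apply: contrapT => /forallNP H; move/eqP: jj'; apply.
  apply: enum_val_inj; apply/ffunP => i.
  by apply/eqP/negPn/negP; exact: H.
- move=> s' sa; have sF : [ffun i => s' i] \in Fam.
    by apply/FamP => i; rewrite ffunE.
  by exists (enum_rank_in sF [ffun i => s' i]) => i; rewrite /s enum_rankK_in // ffunE.
Qed.
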